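(* Let $\alpha=(\alpha_n)_{n\ge1}$ be the Thue–Morse sequence over $\mathbb{F}_2$. Then the substitution $\sigma$ and the coding $\kappa_1$ generate the array $\mathfrak F(\alpha)$; more precisely, $$\left\{\mathfrak F_{m,n}(\alpha)\right\}_{m=1,n=1}^{\infty}=\kappa_1\left(\sigma^\infty(\mathbf a_0)\right)$$ as arrays indexed by $(m,n)\in\mathbb N\times\mathbb N$, $\mathbb{N}=\{1,2,\dots\}$ ($m$ is the row index, increasing downwards, and $n$ is the column index, increasing rightwards).
   Context: Thue–Morse: $\mu(\mathbf a)=\mathbf a\mathbf b$, $\mu(\mathbf b)=\mathbf b\mathbf a$ (extended to words), $\tau(\mathbf a)=0,\tau(\mathbf b)=1$, and $\alpha=(\alpha_n)_{n\ge1}=\tau(\mu^\infty(\mathbf a))=0,1,1,0,1,0,0,1,\dots$, where $\mu^\infty(\mathbf a)=\lim_l\mu^l(\mathbf a)$. The array $\mathfrak F(\alpha)$ over $\mathbb F_2$: for $m,n\ge1$ let $\mathfrak H_{m,n}(\alpha)=\det(\alpha_{n+i+j})_{0\le i,j\le m-1}\in\mathbb F_2$; put $\mathfrak H_{0,n}=1$ for $n\ge1$ and $\mathfrak H_{m,n}=0$ for $m<0$, $n\ge 2|m|+1$. For $m\ge0,n\ge1$ set $\mathfrak F_{m,n}(\alpha)=\mathfrak H_{(m-n+1)/2,\,n}(\alpha)$ if $m\not\equiv n\pmod 2$ and $\mathfrak F_{m,n}(\alpha)=0$ if $m\equiv n\pmod 2$ (a sign appearing in the definition over general $\mathbb{F}_q$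 is trivial over $\mathbb F_2$). Tiles and group: $\Sigma=\{\mathbf a_i,\mathbf b_i,\mathbf c_i: i\in\mathbb Z/4\}\cup\{\mathbf d_{\mathbf a},\mathbf d_{\mathbf b},\mathbf o\}$ (15 symbols). Let $D=\langle\rho,\eta\mid\rho^4,\eta^2,\rho\eta\rho\eta\rangle$ be the dihedral group of order 8, and $G=D\times\langle\iota\mid\iota^2\rangle$. $G$ acts on $\Sigma$ by: $\rho\mathbf x_i=\mathbf x_{i+1}$, $\eta\mathbf x_i=\mathbf x_{-i}$ for $\mathbf x\in\{\mathbf a,\mathbf b,\mathbf c\}$; $\rho$ fixes $\mathbf d_{\mathbf a},\mathbf d_{\mathbf b}$ and $\eta$ swaps them; $\iota$ swaps $\mathbf a_i\leftrightarrow\mathbf b_i$ and $\mathbf d_{\mathbf a}\leftrightarrow\mathbf d_{\mathbf b}$ and fixes each $\mathbf c_i$; everything fixes $\mathbf o$. Action on matrices: for $M\in\mathrm{Mat}_n(\Sigma)$, $T^{\rm ent}_gM$ applies $g$ to each entry; $T^{\rm geo}_g$ is the $G$-action through the projection $G\to D$ in which $\rho$ rotates $M$ by $90^\circ$ clockwise, $\eta$ reflects $M$ along the anti-diagonal, and $\iota$ acts trivially. Let $\psi$ be the automorphism of $G$ with $\psi(\rho)=\iota\rho$, $\psi(\eta)=\iota\eta$, $\psi(\iota)=\iota$. For $M\in\mathrm{Mat}_{2^l}(\Sigma)$ put $gM=T^{\rm geo}_gT^{\rm ent}_{\psi^l(g)}M$. Substitution $\sigma:\Sigma\to\mathrm{Mat}_2(\Sigma)$: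 on representatives, $$\sigma(\mathbf a_0)=\begin{pmatrix}\mathbf a_0&\mathbf c_0\\ \mathbf d_{\mathbf a}&\mathbf b_0\end{pmatrix},\ \sigma(\mathbf c_0)=\begin{pmatrix}\mathbf o&\mathbf o\\ \mathbf c_0&\mathbf o\end{pmatrix},\ \sigma(\mathbf d_{\mathbf a})=\begin{pmatrix}\mathbf b_1&\mathbf a_2\\ \mathbf a_0&\mathbf b_3\end{pmatrix},\ \sigma(\mathbf o)=\begin{pmatrix}\mathbf o&\mathbf o\\ \mathbf o&\mathbf o\end{pmatrix},$$ and in general $\sigma(gs_0)=g\sigma(s_0)$ for $g\in G$ and $s_0\in\{\mathbf a_0,\mathbf c_0,\mathbf d_{\mathbf a},\mathbf o\}$ (this is well defined). $\sigma$ is applied to a matrix by replacing each entry by its $2\times2$ image. Since $\mathbf a_0$ is the top left entry of $\sigma(\mathbf a_0)$, the iterates $\sigma^l(\mathbf a_0)\in\mathrm{Mat}_{2^l}(\Sigma)$ converge to an array $\sigma^\infty(\mathbf a_0)$ of tiles indexed by $\mathbb N^2$. Coding: $\kappa:\Sigma\to\mathrm{Mat}_5(\mathbb F_2)$ has entries $1$ exactly at the following (row, column) positions and $0$ elsewhere: $\kappa(\mathbf o)$: none; $\kappa(\mathbf c_0)$: $(4,1),(5,2)$; $\kappa(\mathbf d_{\mathbf a})$: $(1,2),(2,3),(2,5),(3,2),(3,4),(4,1),(4,3),(5,4)$; $\kappa(\mathbf d_{\mathbf b})$: $(1,4),(2,1),(2,3),(3,2),(3,4),(4,3),(4,5),(5,2)$;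 $\kappa(\mathbf a_0)$: $(1,2),(2,3),(3,2),(3,4),(4,1),(4,3),(4,5),(5,2)$; $\kappa(\mathbf b_0)$: $(1,2),(2,1),(2,3),(3,4),(4,5),(5,4)$; the remaining values are determined by $\kappa(\rho s)=$ the $90^\circ$ clockwise rotation of $\kappa(s)$. The $4$-coding $\kappa_1:\Sigma\to\mathrm{Mat}_4(\mathbb F_2)$ is obtained from $\kappa$ by deleting the last row and column. $\kappa_1(\sigma^\infty(\mathbf a_0))$ is the array over $\mathbb N^2$ obtained by replacing each tile $s$ of $\sigma^\infty(\mathbf a_0)$ by the $4\times4$ block $\kappa_1(s)$. *)

(* Defs.v *)
From HB Require Import structures.
From mathcomp Require Import all_boot all_order all_algebra all_fingroup.

Set Implicit Arguments.
Unset Strict Implicit.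
Unset Printing Implicit Defensive.

Import GRing.Theory.

Local Open Scope ring_scope.

(** * The Thue-Morse sequence *)

Inductive letter := la | lb.

Definition mu (x : letter) : seq letter :=
  match x with la => [:: la; lb] | lb => [:: lb; la] end.

Definition mu_word (w : seq letter) : seq letter := flatten (map mu w).

Definition mu_iter (l : nat) : seq letter := iter l mu_word [:: la].

Definition tau (x : letter) : 'F_2 := match x with la => 0 | lb => 1 end.

(* [mu_inf k] is the letter of index [k] (counted from 0) of the limit of the
   words [mu_iter l]; the word [mu_iter k] has length [2 ^ k > k].  See
   [mu_infE]. *)
Definition mu_inf (k : nat) : letter := nth la (mu_iter k) k.

(* Only the values at [n >= 1] are meaningful. *)
Definition thue_morse (n : nat) : 'F_2 := tau (mu_inf n.-1).

Lemma mu_word_cat u v : mu_word (u ++ v) = mu_word u ++ mu_word v.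
Proof. by rewrite /mu_word map_cat flatten_cat. Qed.

Lemma size_mu_word w : size (mu_word w) = (2 * size w)%N.
Proof.
rewrite /mu_word; elim: w => //= x w IH.
by rewrite size_cat IH mulnS; case: x.
Qed.

Lemma size_mu_iter l : size (mu_iter l) = (2 ^ l)%N.
Proof. by elim: l => // l IH; rewrite /mu_iter iterS size_mu_word IH expnS. Qed.

Lemma mu_iter_prefix l d : exists w, mu_iter (l + d) = mu_iter l ++ w.
Proof.
elim: l => [|l [w E]]; last first.
  by exists (mu_word w); rewrite addSn /mu_iter !iterS -mu_word_cat -E.
elim: d => [|d [w E]]; first by exists [::].
exists (lb :: mu_word w).
by rewrite add0n in E *; rewrite {1}/mu_iter iterS -/(mu_iter d) E mu_word_cat.
Qed.

Lemma mu_infE l k : (k < 2 ^ l)%N -> mu_inf k = nth la (mu_iter l) k.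
Proof.
move=> kl; have kk : (k < 2 ^ k)%N by rewrite ltn_expl.
rewrite /mu_inf; case: (leqP l k) => [lk|/ltnW kl'].
  have [w] := mu_iter_prefix l (k - l); rewrite subnKC // => ->.
  by rewrite nth_cat size_mu_iter kl.
have [w] := mu_iter_prefix k (l - k); rewrite subnKC // => ->.
by rewrite nth_cat size_mu_iter kk.
Qed.

(** * Hankel determinants and the array F *)

(* For [m < 0] only the values at [n >= 2 * |m| + 1] are meaningful; these are
   the only ones used in [hankel_array]. *)
Definition hankel (a : nat -> 'F_2) (m : int) (n : nat) : 'F_2 :=
  match m with
  | Posz 0 => 1
  | Posz k => \det (\matrix_(i < k, j < k) a (n + i + j)%N)
  | Negz _ => 0
  end.

Definition hankel_array (a : nat -> 'F_2) (m n : nat) : 'F_2 :=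
  if (m == n %[mod 2])%N then 0
  else hankel a ((m%:Z - n%:Z + 1) %/ 2)%Z n.

(** * The group G = D * <iota> *)

(* The pair [(k, e)] stands for rho ^ k eta ^ e; the product follows from the
   relation eta rho = rho ^ -1 eta. *)
Definition dih8 : Type := ('Z_4 * bool)%type.

HB.instance Definition _ := Finite.on dih8.

Definition dih8_one : dih8 := (0, false).
Definition dih8_mul (x y : dih8) : dih8 :=
  (x.1 + (if x.2 then - y.1 else y.1), x.2 (+) y.2).
Definition dih8_inv (x : dih8) : dih8 :=
  (if x.2 then x.1 else - x.1, x.2).

Lemma dih8_mulA : associative dih8_mul.
Proof.
move=> [i a] [j b] [k c]; congr (_, _); rewrite /= ?addbA //.
by case: a b => [] [] /=; rewrite ?opprD ?opprK ?addrA.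
Qed.

Lemma dih8_mul1 : left_id dih8_one dih8_mul.
Proof. by move=> [i a]; rewrite /dih8_mul /= add0r. Qed.

Lemma dih8_mulV : left_inverse dih8_one dih8_inv dih8_mul.
Proof.
move=> [i a]; rewrite /dih8_mul /= addbb; congr (_, _).
by case: a => /=; rewrite ?addrN ?addNr.
Qed.

HB.instance Definition _ :=
  Finite_isGroup.Build dih8 dih8_mulA dih8_mul1 dih8_mulV.

(* ['Z_2], with its (additive) group structure, is the factor <iota>. *)
Definition G : finGroupType := (dih8 * 'Z_2)%type.

Definition rhoG : G := ((1, false), 0).
Definition etaG : G := ((0, true), 0).
Definition iotaG : G := ((0, false), 1).

(* Exponents in the normal form rho ^ k eta ^ e iota ^ t; see
   [G_normal_form]. *)
Definition exp_rho (g : G) : nat := g.1.1.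
Definition exp_eta (g : G) : nat := g.1.2.
Definition exp_iota (g : G) : nat := g.2.

Lemma mulGE (x y : G) :
  (x * y)%g =
    ((x.1.1 + (if x.1.2 then - y.1.1 else y.1.1), x.1.2 (+) y.1.2), x.2 + y.2).
Proof. by []. Qed.

Lemma G_eqP (x y : G) :
  val x.1.1 = val y.1.1 -> x.1.2 = y.1.2 -> val x.2 = val y.2 -> x = y.
Proof.
by case: x y => [[k e] t] [[k' e'] t'] /= /val_inj-> -> /val_inj->.
Qed.

Lemma rhoX k : (rhoG ^+ k)%g = ((k%:R, false), 0).
Proof. by elim: k => // k IH; rewrite expgS IH mulGE /= addr0 -nat1r. Qed.

Lemma G_normal_form (g : G) :
  g = (rhoG ^+ exp_rho g * etaG ^+ exp_eta g * iotaG ^+ exp_iota g)%g.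
Proof.
rewrite /exp_rho /exp_eta /exp_iota; case: g => [[k e] t] /=.
rewrite rhoX natr_Zp.
have -> : (iotaG ^+ t)%g = ((0, false), t).
  by case: t => [[|[|//]] ?]; congr (_, _); apply: val_inj.
have -> : (etaG ^+ e)%g = ((0, e), 0) by case: e.
by rewrite !mulGE /= oppr0 if_same !addr0 !add0r addbF.
Qed.

Lemma G_presentation :
  [/\ (rhoG ^+ 4 = 1)%g, (etaG ^+ 2 = 1)%g, (iotaG ^+ 2 = 1)%g,
      (rhoG * etaG * rhoG * etaG = 1)%g &
      (iotaG * rhoG = rhoG * iotaG /\ iotaG * etaG = etaG * iotaG)%g /\
      #|G| = 16%N].
Proof.
split; try exact: G_eqP.
split; first by split; exact: G_eqP.
by rewrite !card_prod card_bool !card_ord.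
Qed.

Definition psi (g : G) : G :=
  ((iotaG * rhoG) ^+ exp_rho g * (iotaG * etaG) ^+ exp_eta g
     * iotaG ^+ exp_iota g)%g.

Lemma psi_gen :
  [/\ psi rhoG = (iotaG * rhoG)%g, psi etaG = (iotaG * etaG)%g &
      psi iotaG = iotaG].
Proof. by split; exact: G_eqP. Qed.

(* The generators act by [r], [e], [i]; this is a left action of [G] as soon as
   these maps satisfy the relations of [G], see [act_of_genM]. *)
Definition act_of_gen (T : Type) (r e i : T -> T) (g : G) (x : T) : T :=
  iter (exp_rho g) r (iter (exp_eta g) e (iter (exp_iota g) i x)).

Lemma G_ind (P : G -> Prop) :
  P 1%g -> (forall g, P g -> P (rhoG * g)%g) ->
  (forall g, P g -> P (etaG * g)%g) -> (forall g, P g -> P (iotaG * g)%g) ->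
  forall g, P g.
Proof.
move=> P1 Pr Pe Pi g; rewrite (G_normal_form g) -!mulgA.
elim: (exp_rho g) => [|k IH]; last by rewrite expgS -mulgA; apply: Pr.
rewrite mul1g.
elim: (exp_eta g) => [|k IH]; last by rewrite expgS -mulgA; apply: Pe.
rewrite mul1g.
elim: (exp_iota g) => [|k IH]; last by rewrite expgS; apply: Pi.
exact: P1.
Qed.

Lemma psiM : {morph psi : g h / (g * h)%g}.
Proof.
have gen x : x \in [:: rhoG; etaG; iotaG] ->
    forall h, psi (x * h)%g = (psi x * psi h)%g.
  by rewrite !inE => /or3P[] /eqP-> [[[[|[|[|[|//]]]] ?] []] [[|[|//]] ?]];
    exact: G_eqP.
have psi1 : psi 1%g = 1%g by exact: G_eqP.
move=> g h; elim/G_ind: g => [|g IH|g IH|g IH]; first by rewrite psi1 !mul1g.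
- by rewrite -mulgA !(gen rhoG) ?inE ?eqxx // IH mulgA.
- by rewrite -mulgA !(gen etaG) ?inE ?eqxx ?orbT // IH mulgA.
- by rewrite -mulgA !(gen iotaG) ?inE ?eqxx ?orbT // IH mulgA.
Qed.

Section ActOfGen.
Variables (T : Type) (r e i : T -> T).
Hypotheses (r4 : forall x, r (r (r (r x))) = x) (e2 : involutive e)
  (i2 : involutive i) (rere : forall x, r (e (r (e x))) = x)
  (ri : forall x, i (r x) = r (i x)) (ei : forall x, i (e x) = e (i x)).

Lemma act_of_genM g h x :
  act_of_gen r e i (g * h)%g x = act_of_gen r e i g (act_of_gen r e i h x).
Proof.
pose A := act_of_gen r e i.
have er z : e (r z) = r (r (r (e z))).
  by have := rere (e z); rewrite e2 => <-; rewrite r4.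
have Ar k y : A (rhoG * k)%g y = r (A k y).
  by case: k => [[[[|[|[|[|//]]]] ?] []] [[|[|//]] ?]];
    rewrite /A /act_of_gen /= ?r4.
have Ae k y : A (etaG * k)%g y = e (A k y).
  by case: k => [[[[|[|[|[|//]]]] ?] []] [[|[|//]] ?]];
    rewrite /A /act_of_gen /= ?er ?r4 ?e2.
have Ai k y : A (iotaG * k)%g y = i (A k y).
  by case: k => [[[[|[|[|[|//]]]] ?] []] [[|[|//]] ?]];
    rewrite /A /act_of_gen /= ?ri ?ei ?i2.
elim/G_ind: g => [|g IH|g IH|g IH]; first by rewrite mul1g.
- by rewrite -mulgA -/A !Ar -[A g _]IH.
- by rewrite -mulgA -/A !Ae -[A g _]IH.
- by rewrite -mulgA -/A !Ai -[A g _]IH.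
Qed.
End ActOfGen.

(** * Tiles *)

Inductive tile :=
  | TA of 'Z_4 | TB of 'Z_4 | TC of 'Z_4 | TDa | TDb | TO.

Lemma tileP (s t : tile) :
  match s, t with
  | TA i, TA j | TB i, TB j | TC i, TC j => val i = val j
  | TDa, TDa | TDb, TDb | TO, TO => True
  | _, _ => False
  end -> s = t.
Proof. by case: s t => [i|i|i|||] [j|j|j|||] //= /val_inj->. Qed.

Definition tile_rho (s : tile) : tile :=
  match s with
  | TA i => TA (i + 1) | TB i => TB (i + 1) | TC i => TC (i + 1)
  | TDa => TDa | TDb => TDb | TO => TO
  end.

Definition tile_eta (s : tile) : tile :=
  match s with
  | TA i => TA (- i) | TB i => TB (- i) | TC i => TC (- i)
  | TDa => TDb | TDb => TDa | TO => TO
  end.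

Definition tile_iota (s : tile) : tile :=
  match s with
  | TA i => TB i | TB i => TA i | TC i => TC i
  | TDa => TDb | TDb => TDa | TO => TO
  end.

Definition tile_act : G -> tile -> tile :=
  act_of_gen tile_rho tile_eta tile_iota.

Lemma tile_actM g h s : tile_act (g * h)%g s = tile_act g (tile_act h s).
Proof.
have f4 (i : 'Z_4) : i + 1 + 1 + 1 + 1 = i.
  by case: i => [[|[|[|[|//]]]] ?]; apply: val_inj.
apply: act_of_genM => [] [i|i|i|||] //=; rewrite ?f4 ?opprK // opprD opprK.
- by rewrite subrK.
- by rewrite subrK.
- by rewrite subrK.
Qed.

(** * Matrices of tiles *)

Definition rot90 (T : Type) n (M : 'M[T]_n) : 'M[T]_n :=
  \matrix_(i, j) M (rev_ord j) i.

Definition flip_antidiag (T : Type) n (M : 'M[T]_n) : 'M[T]_n :=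
  \matrix_(i, j) M (rev_ord j) (rev_ord i).

Definition act_geo n : G -> 'M[tile]_n -> 'M[tile]_n :=
  act_of_gen (@rot90 tile n) (@flip_antidiag tile n) id.

Definition act_ent n (g : G) (M : 'M[tile]_n) : 'M[tile]_n :=
  map_mx (tile_act g) M.

Definition act_mx l (g : G) (M : 'M[tile]_(2 ^ l)) : 'M[tile]_(2 ^ l) :=
  act_geo g (act_ent (iter l psi g) M).

Lemma act_geoM n g h (M : 'M_n) : act_geo (g * h)%g M = act_geo g (act_geo h M).
Proof.
by apply: act_of_genM => // N; apply/matrixP=> i j; rewrite !mxE !rev_ordK.
Qed.

Lemma act_entM n g h (M : 'M_n) : act_ent (g * h)%g M = act_ent g (act_ent h M).
Proof. by apply/matrixP=> i j; rewrite !mxE tile_actM. Qed.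

Lemma act_geo_ent n g h (M : 'M_n) :
  act_geo g (act_ent h M) = act_ent h (act_geo g M).
Proof.
elim/G_ind: g => [|g IH|g IH|g IH] //; rewrite !act_geoM IH;
  by apply/matrixP=> i j; rewrite !mxE.
Qed.

Lemma act_mxM l g h (M : 'M_(2 ^ l)) :
  act_mx (g * h)%g M = act_mx g (act_mx h M).
Proof.
rewrite /act_mx act_geoM -act_geo_ent -act_entM.
congr (act_geo _ (act_geo _ _)).
by congr (act_ent _ _); elim: l {M} => //= l ->; rewrite psiM.
Qed.

(** * The substitution *)

Definition mx22 (T : Type) (a b c d : T) : 'M[T]_2 :=
  \matrix_(i, j) if i == 0 then if j == 0 then a else b
                 else if j == 0 then c else d.

Definition sigma_a0 : 'M[tile]_2 := mx22 (TA 0) (TC 0) TDa (TB 0).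
Definition sigma_c0 : 'M[tile]_2 := mx22 TO TO (TC 0) TO.
Definition sigma_da : 'M[tile]_2 := mx22 (TB 1) (TA 2%:R) (TA 0) (TB 3%:R).
Definition sigma_o : 'M[tile]_2 := mx22 TO TO TO TO.

(* Every tile is written as [g s0] for one chosen [g] and a representative
   [s0]; [sigma_act] shows that the choice is immaterial. *)
Definition sigma (s : tile) : 'M[tile]_2 :=
  match s with
  | TA i => act_mx (l := 1) (rhoG ^+ i)%g sigma_a0
  | TB i => act_mx (l := 1) (rhoG ^+ i * iotaG)%g sigma_a0
  | TC i => act_mx (l := 1) (rhoG ^+ i)%g sigma_c0
  | TDa => sigma_da
  | TDb => act_mx (l := 1) iotaG sigma_da
  | TO => sigma_o
  end.

Lemma sigma_rep :
  [/\ sigma (TA 0) = sigma_a0, sigma (TC 0) = sigma_c0, sigma TDa = sigma_da &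
      sigma TO = sigma_o].
Proof. by split => //; apply/matrixP=> i j; rewrite !mxE. Qed.

Lemma act_mx1 l (M : 'M_(2 ^ l)) : act_mx 1%g M = M.
Proof.
rewrite /act_mx (_ : iter l psi 1%g = 1%g); last first.
  by elim: l {M} => //= l ->; exact: G_eqP.
by apply/matrixP=> i j; rewrite mxE.
Qed.

Lemma act_mx_rho (M : 'M_2) :
  act_mx (l := 1) rhoG M = rot90 (map_mx (tile_iota \o tile_rho) M).
Proof.
have [pE _ _] := psi_gen; rewrite /act_mx /= pE.
by apply/matrixP=> i j; rewrite !mxE tile_actM.
Qed.

Lemma act_mx_eta (M : 'M_2) :
  act_mx (l := 1) etaG M = flip_antidiag (map_mx (tile_iota \o tile_eta) M).
Proof.
have [_ pE _] := psi_gen; rewrite /act_mx /= pE.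
by apply/matrixP=> i j; rewrite !mxE tile_actM.
Qed.

Lemma act_mx_iota (M : 'M_2) :
  act_mx (l := 1) iotaG M = map_mx tile_iota M.
Proof.
have [_ _ pE] := psi_gen; rewrite /act_mx /= pE.
by apply/matrixP=> i j; rewrite !mxE.
Qed.

Lemma sigma_act g s : sigma (tile_act g s) = act_mx (l := 1) g (sigma s).
Proof.
have aM h k (M : 'M_2) :
    act_mx (l := 1) (h * k)%g M = act_mx (l := 1) h (act_mx (l := 1) k M).
  exact: (@act_mxM 1).
have a1 (M : 'M_2) : act_mx (l := 1) 1%g M = M by exact: (@act_mx1 1).
pose gE := (act_mx_rho, act_mx_eta, act_mx_iota).
have ea : act_mx (l := 1) etaG sigma_a0 = sigma_a0.
  rewrite gE;
  apply/matrixP=> [] [[|[|//]] ?] [[|[|//]] ?];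
  rewrite !mxE /=; exact: tileP.
have ec : act_mx (l := 1) etaG sigma_c0 = sigma_c0.
  rewrite gE;
  apply/matrixP=> [] [[|[|//]] ?] [[|[|//]] ?];
  rewrite !mxE /=; exact: tileP.
have ic : act_mx (l := 1) iotaG sigma_c0 = sigma_c0.
  rewrite gE;
  apply/matrixP=> [] [[|[|//]] ?] [[|[|//]] ?];
  by rewrite !mxE.
have rd : act_mx (l := 1) rhoG sigma_da = sigma_da.
  rewrite gE;
  apply/matrixP=> [] [[|[|//]] ?] [[|[|//]] ?];
  rewrite !mxE /=; exact: tileP.
have ed : act_mx (l := 1) etaG sigma_da = act_mx (l := 1) iotaG sigma_da.
  rewrite !gE;
  apply/matrixP=> [] [[|[|//]] ?] [[|[|//]] ?];
  rewrite !mxE /=; exact: tileP.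
have go g' : act_mx (l := 1) g' sigma_o = sigma_o.
  elim/G_ind: g' => [|g' IH|g' IH|g' IH];
    rewrite ?aM ?IH ?a1 // gE;
    by apply/matrixP=> [] [[|[|//]] ?] [[|[|//]] ?]; rewrite !mxE.
have [r4 e2 i2 rere [[ri ei] _]] := G_presentation.
have rS (i : 'Z_4) : (rhoG ^+ (i + 1)%R = rhoG * rhoG ^+ i)%g.
  by rewrite -expgS !rhoX natr_Zp -natr1 natr_Zp.
have rN (i : 'Z_4) : (rhoG ^+ (- i)%R * etaG = etaG * rhoG ^+ i)%g.
  by rewrite !rhoX !natr_Zp !mulGE /= !add0r !addr0.
have rI (i : 'Z_4) : (iotaG * rhoG ^+ i = rhoG ^+ i * iotaG)%g.
  by rewrite rhoX !mulGE /= !addr0 !add0r.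
elim/G_ind: g => [|g IH|g IH|g IH]; first by rewrite a1; case: s.
- rewrite tile_actM aM -IH; case: (tile_act g s) => [i|i|i|||] /=;
    by rewrite ?rS -?aM ?mulgA ?go // -?ri ?aM rd.
- rewrite tile_actM aM -IH; case: (tile_act g s) => [i|i|i|||] /=.
  + by rewrite -aM -rN aM ea.
  + by rewrite -aM mulgA -rN -mulgA -ei mulgA (aM _ etaG) ea.
  + by rewrite -aM -rN aM ec.
  + by rewrite ed.
  + by rewrite -ed -aM [(etaG * etaG)%g]e2 a1.
  + by rewrite go.
- rewrite tile_actM aM -IH; case: (tile_act g s) => [i|i|i|||] /=.
  + by rewrite -aM rI.
  + by rewrite -aM mulgA rI -mulgA [(iotaG * iotaG)%g]i2 mulg1.
  + by rewrite -aM rI aM ic.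
  + by [].
  + by rewrite -aM [(iotaG * iotaG)%g]i2 a1.
  + by rewrite go.
Qed.

Lemma ord_div_subproof n k (i : 'I_(n * k)) : (i %/ k < n)%N.
Proof.
case: i => i ik /=; rewrite ltn_divLR //.
by case: k ik => // ik; move: ik; rewrite muln0.
Qed.

Lemma ord_mod_subproof n k (i : 'I_(n * k)) : (i %% k < k)%N.
Proof.
case: i => i ik /=; rewrite ltn_mod.
by case: k ik => // ik; move: ik; rewrite muln0.
Qed.

Definition ord_div n k (i : 'I_(n * k)) : 'I_n := Ordinal (ord_div_subproof i).
Definition ord_mod n k (i : 'I_(n * k)) : 'I_k := Ordinal (ord_mod_subproof i).

(* Each entry [x] of [M] is replaced by the block [f x]. *)
Definition subst_mx (S T : Type) n k (f : S -> 'M[T]_k) (M : 'M[S]_n) :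
    'M[T]_(n * k) :=
  \matrix_(i, j) f (M (ord_div i) (ord_div j)) (ord_mod i) (ord_mod j).

Fixpoint sigma_iter (l : nat) : 'M[tile]_(2 ^ l) :=
  match l with
  | 0 => const_mx (TA 0)
  | l'.+1 => castmx (esym (expnSr 2 l'), esym (expnSr 2 l'))
                    (subst_mx sigma (sigma_iter l'))
  end.

Lemma sigma_inf_subproof i j :
  (i < 2 ^ maxn i j)%N /\ (j < 2 ^ maxn i j)%N.
Proof.
by split; apply: leq_ltn_trans (ltn_expl (maxn i j) (ltnSn 1));
  rewrite ?leq_maxl ?leq_maxr.
Qed.

(* Arrays over N ^ 2 are indexed from 0 here; [sigma_infE] shows that this is
   the limit of the matrices [sigma_iter l]. *)
Definition sigma_inf (i j : nat) : tile :=
  sigma_iter (maxn i j) (Ordinal (proj1 (sigma_inf_subproof i j)))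
                        (Ordinal (proj2 (sigma_inf_subproof i j))).

Lemma sigma_inf_stable l d (i j : 'I_(2 ^ l)) (i' j' : 'I_(2 ^ (l + d))) :
  i = i' :> nat -> j = j' :> nat ->
  sigma_iter (l + d) i' j' = sigma_iter l i j.
Proof.
have base : sigma (TA 0) 0 0 = TA 0 by case: sigma_rep => ->; rewrite mxE.
elim: l i j i' j' => [|l IH] i j i' j' ii jj; last first.
  rewrite /= !castmxE !mxE /=; congr (sigma _ _ _); last 2 first.
  - by apply: val_inj; rewrite /= ii.
  - by apply: val_inj; rewrite /= jj.
  by apply: IH; rewrite /= ?ii ?jj.
have [i0 j0] : i' = 0 :> nat /\ j' = 0 :> nat.
  by rewrite -ii -jj !ord1.
rewrite [RHS]mxE; elim: d i' j' {ii jj} i0 j0 => [|d IH] i' j' i0 j0.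
  by rewrite mxE.
rewrite /= castmxE mxE -[RHS]base; congr (sigma _ _ _).
- by apply: IH; rewrite /= ?i0 ?j0.
- by apply: val_inj; rewrite /= i0.
- by apply: val_inj; rewrite /= j0.
Qed.

Lemma sigma_infE l (i j : 'I_(2 ^ l)) : sigma_inf i j = sigma_iter l i j.
Proof.
rewrite /sigma_inf; set i' := Ordinal _; set j' := Ordinal _.
have ii : i' = i :> nat by []. have jj : j' = j :> nat by [].
move: (maxn i j) i' j' ii jj => m i' j' ii jj.
case: (leqP l m) => [lm|/ltnW ml].
  move: i' j' ii jj; rewrite -(subnKC lm) => i' j' ii jj.
  exact: sigma_inf_stable.
move: i j ii jj; rewrite -(subnKC ml) => i j ii jj.
by apply/esym/sigma_inf_stable.
Qed.

(** * The coding *)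

Definition mx_of_positions n (s : seq (nat * nat)) : 'M['F_2]_n :=
  \matrix_(i, j) ((i.+1, j.+1) \in s)%:R.

Definition kappa_a0 : 'M['F_2]_5 := mx_of_positions 5
  [:: (1, 2); (2, 3); (3, 2); (3, 4); (4, 1); (4, 3); (4, 5); (5, 2)]%N.
Definition kappa_b0 : 'M['F_2]_5 := mx_of_positions 5
  [:: (1, 2); (2, 1); (2, 3); (3, 4); (4, 5); (5, 4)]%N.
Definition kappa_c0 : 'M['F_2]_5 := mx_of_positions 5
  [:: (4, 1); (5, 2)]%N.
Definition kappa_da : 'M['F_2]_5 := mx_of_positions 5
  [:: (1, 2); (2, 3); (2, 5); (3, 2); (3, 4); (4, 1); (4, 3); (5, 4)]%N.
Definition kappa_db : 'M['F_2]_5 := mx_of_positions 5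
  [:: (1, 4); (2, 1); (2, 3); (3, 2); (3, 4); (4, 3); (4, 5); (5, 2)]%N.

Definition kappa (s : tile) : 'M['F_2]_5 :=
  match s with
  | TA i => iter i (@rot90 'F_2 5) kappa_a0
  | TB i => iter i (@rot90 'F_2 5) kappa_b0
  | TC i => iter i (@rot90 'F_2 5) kappa_c0
  | TDa => kappa_da
  | TDb => kappa_db
  | TO => 0
  end.

Lemma kappa_rho s : kappa (tile_rho s) = rot90 (kappa s).
Proof.
have r4 (M : 'M['F_2]_5) : rot90 (rot90 (rot90 (rot90 M))) = M.
  by apply/matrixP=> i j; rewrite !mxE !rev_ordK.
case: s => [i|i|i|||] /=; last first.
- by apply/matrixP=> i j; rewrite !mxE.
- by apply/matrixP=> [] [[|[|[|[|[|//]]]]] ?] [[|[|[|[|[|//]]]]] ?];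
  rewrite !mxE.
- by apply/matrixP=> [] [[|[|[|[|[|//]]]]] ?] [[|[|[|[|[|//]]]]] ?];
  rewrite !mxE.
all: by case: i => [[|[|[|[|//]]]] ?] //=; rewrite r4.
Qed.

Definition kappa1 (s : tile) : 'M['F_2]_4 :=
  row' ord_max (col' ord_max (kappa s)).

(* As [subst_mx], for arrays over N ^ 2 (indexed from 0). *)
Definition subst_array (S T : Type) k (f : S -> 'M[T]_k.+1)
    (A : nat -> nat -> S) (i j : nat) : T :=
  f (A (i %/ k.+1)%N (j %/ k.+1)%N) (inord (i %% k.+1)) (inord (j %% k.+1)).

(* Main.v *)
Require Import Defs.
From mathcomp Require Import all_boot all_order all_algebra all_fingroup.
From mathcomp Require Import zify.

(** Write [f] for the Thue-Morse sequence indexed from 0, so that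
    [f (2 n) = f n] and [f (2 n + 1) = f n + 1], write [d n = f n + f (n + 1)]
    for its difference sequence, and consider together the Hankel determinants
    of the four sequences [f], [f + 1], [d] and [d + 1].

    Sort the rows and the columns of a Hankel matrix of [f] or [d] by the parity
    of their index.  The two defining rules turn each of the four blocks into a
    constant matrix or a Hankel matrix of half the size, up to adding the
    all-ones matrix [ones].  Elementary row operations and the same column
    operations then make the off-diagonal blocks equal to [ones] or 0, or else
    make a diagonal block vanish, in which case the determinant is that of the
    off-diagonal block squared, or 0.  Since [ones] has rank one, a matrix whose
    two diagonal blocks [X] and [Y] are coupled by [ones] has a determinant that
    depends only on those of [X], [X + ones], [Y] and [Y + ones]
    ([det_coupling]); and adding [ones] to a Hankel matrix of a sequence replaces
    the sequence by its complement.  Hence the family of four determinants is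
    closed under halving: the values at size [2 k + b] and offset [2 n + e] are a
    fixed boolean function of the values at sizes [k], [k + 1] and offsets [n],
    [n + 1] ([table_halve]).

    Consequently the array is generated by a finite automaton.  Around the
    4 x 4 block of index [(I, J)] take a window of 6 x 6 quadruples of
    determinants; six is the width that halving preserves.  The window of
    [(2 I + x, 2 J + y)] is computed from the window of [(I, J)]
    ([window_refine]), just as the tile at [(2 I + x, 2 J + y)] is computed from
    the tile at [(I, J)] by the substitution.  Running both computations from
    the origin reaches finitely many pairs (tile, window), and in each of them
    the coding of the tile agrees with the determinants of the window
    ([coding_invariant], a finite check by evaluation). *)

Set Implicit Arguments.
Unset Strict Implicit.
Unset Printing Implicit Defensive.

Import GRing.Theory.

Local Open Scope ring_scope.

Local Notation ones := (const_mx 1).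

(** * Arithmetic in the field with two elements *)

Lemma F2_ind (P : 'F_2 -> Prop) : P 0 -> P 1 -> forall x, P x.
Proof.
move=> P0 P1 [[|[|//]] i].
  by rewrite (_ : Ordinal i = 0) //; apply: val_inj.
by rewrite (_ : Ordinal i = 1) //; apply: val_inj.
Qed.

Lemma F2_addxx (x : 'F_2) : x + x = 0.
Proof. by elim/F2_ind: x; apply: val_inj. Qed.

Lemma F2_opp (x : 'F_2) : - x = x.
Proof. by apply/eqP; rewrite eqr_oppLR -addr_eq0 F2_addxx. Qed.

Lemma F2_mulxx (x : 'F_2) : x * x = x.
Proof. by elim/F2_ind: x; apply: val_inj. Qed.

Lemma F2_addmx m n (A : 'M['F_2]_(m, n)) : A + A = 0.
Proof. by apply/matrixP=> i j; rewrite !mxE F2_addxx. Qed.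

Lemma F2_oppmx m n (A : 'M['F_2]_(m, n)) : - A = A.
Proof. by apply/matrixP=> i j; rewrite !mxE F2_opp. Qed.

Lemma F2_mul_ones m n :
  (ones : 'M['F_2]_(m, 1)) *m (ones : 'M_(1, n)) = ones.
Proof. by apply/matrixP=> i j; rewrite !mxE big_ord1 !mxE mulr1. Qed.

Definition nz (x : 'F_2) : bool := x != 0.

Lemma nzK x : (nz x)%:R = x.
Proof. by elim/F2_ind: x; rewrite /nz ?eqxx ?oner_neq0. Qed.

Lemma nzD x y : nz (x + y) = nz x (+) nz y.
Proof. by elim/F2_ind: x; elim/F2_ind: y. Qed.

Lemma nzM x y : nz (x * y) = nz x && nz y.
Proof. by rewrite /nz mulf_eq0 negb_or. Qed.

(** * Determinants of block matrices *)

Lemma det_reindex (R : comNzRingType) m n (f : 'I_m -> 'I_n) (A : 'M[R]_n) :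
  m = n -> injective f -> \det (mxsub f f A) = \det A.
Proof.
move=> mn; subst m => inj_f.
have -> : mxsub f f A = row_perm (perm inj_f) (col_perm (perm inj_f) A).
  by apply/matrixP=> i j; rewrite !mxE !permE.
rewrite row_permE col_permE !det_mulmx !det_perm odd_permV mulrCA -expr2.
by rewrite sqrr_sign mulr1.
Qed.

(** Multiplication on both sides by unipotent matrices: row [g j] is added to
    row [p + j] and column [g j] to column [p + j], for all [j] at once. *)
Lemma det_shear (R : comNzRingType) p q (g : 'I_q -> 'I_p)
    (X : 'M[R]_p) (Y : 'M_(p, q)) Z W :
  \det (block_mx X Y Z W) =
  \det (block_mx X (Y + colsub g X) (Z + rowsub g X)
                 (W + colsub g Z + rowsub g (Y + colsub g X))).
Proof.
pose L : 'M[R]_(p + q) := block_mx 1%:M 0 (rowsub g 1%:M) 1%:M.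
pose U : 'M[R]_(p + q) := block_mx 1%:M (colsub g 1%:M) 0 1%:M.
transitivity (\det (L *m (block_mx X Y Z W *m U))).
  by rewrite !det_mulmx det_lblock det_ublock !det1 !mul1r mulr1.
rewrite !mulmx_block !mul_rowsub_mx !mulmx_colsub !mulmx1 !mul1mx !mulmx0.
rewrite !mul0mx !addr0; congr (\det (block_mx _ _ _ _)).
- by rewrite addrC.
- by rewrite addrC.
- by rewrite addrC [colsub g Z + W]addrC [colsub g X + Y]addrC.
Qed.

(** Schur complement of a pivot equal to 1. *)
Lemma det_pivot1 (R : comNzRingType) m (v : 'rV[R]_m) (u : 'cV_m) X :
  \det (block_mx 1%:M v u X) = \det (X - u *m v).
Proof.
transitivity (\det (block_mx 1%:M v u X *m block_mx 1%:M (- v) 0 1%:M)).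
  by rewrite det_mulmx det_ublock !det1 !mulr1.
rewrite mulmx_block !mulmx1 !mulmx0 !mul1mx addr0 addNr mulmxN addr0.
by rewrite det_lblock det1 mul1r addrC.
Qed.

Lemma det_row0D (R : comNzRingType) m (u v : 'rV[R]_(1 + m)) A :
  \det (col_mx (u + v) A) = \det (col_mx u A) + \det (col_mx v A).
Proof.
rewrite -[\det (col_mx u A)]mul1r -[\det (col_mx v A)]mul1r.
apply: (determinant_multilinear (i0 := lshift m 0)).
- by rewrite !rowKu !scale1r; apply/rowP=> j; rewrite !mxE.
- by apply/matrixP=> i j; rewrite !mxE; case: splitP => //= k; rewrite [k]ord1.
- by apply/matrixP=> i j; rewrite !mxE; case: splitP => //= k; rewrite [k]ord1.
Qed.

Lemma det_col0D (R : comNzRingType) m (u v : 'cV[R]_(1 + m)) A :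
  \det (row_mx (u + v) A) = \det (row_mx u A) + \det (row_mx v A).
Proof.
by rewrite -det_tr tr_row_mx linearD det_row0D -!tr_row_mx !det_tr.
Qed.

(** The block matrix is [diag (X + ones, Y + ones) + ones], hence the Schur
    complement of a pivot 1 in the matrix obtained by bordering
    [diag (X + ones, Y + ones)] with a row and a column of ones.  In its first row
    the part over [X] is split off: without it, elimination of the pivot leaves a
    block triangular matrix; alone, it gives one after a change of grouping. *)
Lemma det_coupling p q (X : 'M['F_2]_p) (Y : 'M['F_2]_q) :
  \det (block_mx X ones ones Y) =
  \det X * \det (Y + ones) + \det (X + ones) * \det Y
  + \det (X + ones) * \det (Y + ones).
Proof.
have assoc (a : 'M['F_2]_1) (b : 'M_(1, p)) (c : 'M_(1, q)) d d'
      (A : 'M_p) B C (D : 'M_q) :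
    block_mx a (row_mx b c) (col_mx d d') (block_mx A B C D) =
    block_mx (block_mx a b d A) (col_mx c B) (row_mx d' C) D.
  by rewrite block_mxA castmx_id.
have -> : block_mx X ones ones Y =
    block_mx (X + ones) 0 0 (Y + ones)
    - (ones : 'M_(p + q, 1)) *m (ones : 'M_(1, p + q)).
  rewrite F2_mul_ones F2_oppmx -(block_mx_const p q p q 1).
  by rewrite add_block_mx !add0r -!addrA !F2_addmx !addr0.
rewrite -det_pivot1.
rewrite (_ : block_mx _ _ _ _ =
  col_mx (row_mx 1%:M (row_mx 0 ones) + row_mx 0 (row_mx ones 0))
    (row_mx ones (block_mx (X + ones) 0 0 (Y + ones)))); last first.
  by rewrite !add_row_mx !add0r !addr0 row_mx_const.
rewrite det_row0D -!/(block_mx _ _ _ _).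
rewrite det_pivot1.
rewrite -(col_mx_const p q 1 1) assoc col_mx0.
rewrite [U in _ + U = _](@det_lblock _ (1 + p) q).
rewrite mul_col_row mulmx0 mulmx0 !F2_mul_ones F2_oppmx.
rewrite add_block_mx !addr0 !add0r -addrA F2_addmx addr0 det_ublock.
rewrite [U in _ + \det U * _ = _](_ : _ =
  col_mx (row_mx 1%:M ones + row_mx 1%:M 0) (row_mx ones (X + ones)));
  last first.
  by rewrite add_row_mx F2_addmx addr0.
rewrite det_row0D -!/(block_mx _ _ _ _) det_pivot1 det_lblock det1 mul1r.
rewrite F2_mul_ones F2_oppmx -addrA F2_addmx addr0.
by rewrite mulrDl addrCA addrA.
Qed.

Lemma det_swap_blocks k (X Y Z W : 'M['F_2]_k) :
  \det (block_mx X Y Z W) = \det (block_mx Z W X Y).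
Proof.
pose S : 'M['F_2]_(k + k) := block_mx 0 1%:M 1%:M 0.
have S1 : \det S = 1.
  rewrite -[LHS]F2_mulxx -det_mulmx mulmx_block !mulmx0 !mul0mx !mulmx1.
  by rewrite !addr0 !add0r -scalar_mx_block det1.
transitivity (\det (S *m block_mx X Y Z W)).
  by rewrite det_mulmx S1 mul1r.
by rewrite mulmx_block !mul0mx !mul1mx !addr0 !add0r.
Qed.

Lemma det_zero_ulblock k (P Q W : 'M['F_2]_k) :
  \det (block_mx 0 P Q W) = \det P * \det Q.
Proof. by rewrite det_swap_blocks det_ublock mulrC. Qed.

Lemma det_zero_drblock k (P Q W : 'M['F_2]_k) :
  \det (block_mx W P Q 0) = \det P * \det Q.
Proof. by rewrite det_swap_blocks det_lblock mulrC. Qed.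

(** The rows that meet the zero block are more numerous than their nonzero
    columns, so they are linearly dependent. *)
Lemma det_large_zero_block (F : fieldType) p q (M : 'M[F]_(p, q)) N W :
  (q < p)%N -> \det (block_mx (0 : 'M_p) M N W) = 0.
Proof.
move=> qp.
have /rowV0Pn[v /sub_kermxP vM v0] : kermx M != 0.
  rewrite -mxrank_eq0 mxrank_ker subn_eq0 -ltnNge.
  exact: leq_ltn_trans (rank_leq_col M) qp.
apply/eqP/det0P; exists (row_mx v 0).
  by apply: contra v0; rewrite -row_mx0 => /eqP/eq_row_mx [-> _].
by rewrite mul_row_block !mulmx0 !mul0mx !addr0 vM row_mx0.
Qed.

(** Adding each column to the next one makes all columns but the first
    insensitive to the addition of [ones], so the sum of the two determinants is a
    single one whose first column consists of ones; its first entry then serves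
    as a pivot. *)
Lemma det_complement_diff k (X : 'M['F_2]_(1 + k)) :
  \det X + \det (X + ones) =
  \det (\matrix_(i < k, j < k)
     (X (rshift 1 i) (rshift 1 j) + X (rshift 1 i) (lift ord_max j)
      + (X 0 (rshift 1 j) + X 0 (lift ord_max j)))).
Proof.
(* [C] adds column [j] to column [j + 1]. *)
pose w : 'I_k -> 'I_(1 + k) := lift ord_max.
pose C : 'M['F_2]_(1 + k) := 1%:M + row_mx 0 (colsub w 1%:M).
have eq_w (i : 'I_(1 + k)) l : (i == w l) = (i == l :> nat).
  by rewrite -(inj_eq val_inj) /= /bump leqNgt ltn_ord.
have detC : \det C = 1.
  rewrite -det_tr det_trig ?big1 // => [i _|].
    rewrite !mxE eqxx; case: splitP => j ij; rewrite !mxE ?addr0 //.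
    by rewrite eq_w ij gtn_eqF ?addr0.
  apply/is_trig_mxP => i j ij; rewrite !mxE.
  rewrite -val_eqE gtn_eqF // add0r; case: splitP => l il; rewrite !mxE //.
  by rewrite eq_w gtn_eqF // (leq_ltn_trans _ ij) //= il leq_addl.
have diff (A : 'M['F_2]_(1 + k)) : \det A =
      \det (row_mx (lsubmx A) (colsub (@rshift 1 k) A + colsub w A)).
  transitivity (\det (A *m C)); first by rewrite det_mulmx detC mulr1.
  rewrite mulmxDr mulmx1 mul_mx_row mulmx0.
  rewrite mulmx_colsub mulmx1 -{1}[A]hsubmxK add_row_mx addr0.
  by congr (\det (row_mx _ (_ + _))); apply/matrixP => i j; rewrite !mxE.
rewrite diff (diff (X + ones)).
set M := (colsub _ _ + _).
rewrite [U in _ + \det (row_mx _ U)](_ : _ = M); last first.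
  apply/matrixP=> i j; rewrite !mxE.
  by rewrite addrACA F2_addxx addr0.
rewrite -det_col0D.
rewrite (_ : lsubmx X + _ = ones); last first.
  by rewrite linearD addrA F2_addmx add0r; apply/matrixP=> i j; rewrite !mxE.
rewrite -[M]vsubmxK -[ones](col_mx_const 1 k 1 1) -block_mxEh.
rewrite (_ : const_mx 1 = 1%:M :> 'M_1); last first.
  by apply/matrixP=> i j; rewrite !ord1 !mxE.
rewrite det_pivot1; congr (\det _); apply/matrixP=> i j.
rewrite !mxE big_ord1 !mxE mul1r F2_opp.
by rewrite (_ : lshift k ord0 = 0) //; apply: val_inj.
Qed.

(** * Hankel determinants of a sequence and of its difference *)

Definition hankel_mx p q (f : nat -> 'F_2) (N : nat) : 'M['F_2]_(p, q) :=
  \matrix_(i, j) f (N + i + j)%N.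
Definition hankel_det k f N := \det (hankel_mx k k f N).
Definition compl (f : nat -> 'F_2) n := f n + 1.
Definition diff (f : nat -> 'F_2) n := f n + f n.+1.

Lemma hankel_mx_compl p q f N :
  hankel_mx p q (compl f) N = hankel_mx p q f N + ones.
Proof. by apply/matrixP=> i j; rewrite !mxE. Qed.

Lemma eq_hankel_det k g h N : g =1 h -> hankel_det k g N = hankel_det k h N.
Proof. by move=> e; congr (\det _); apply/matrixP=> i j; rewrite !mxE. Qed.

Lemma complK g n : compl (compl g) n = g n.
Proof. by rewrite /compl -addrA F2_addxx addr0. Qed.

Lemma compl_ext f g : f =1 g -> compl f =1 compl g.
Proof. by move=> e n; rewrite /compl e. Qed.

Lemma diff_compl f : diff (compl f) =1 diff f.
Proof. by move=> n; rewrite /diff /compl addrACA F2_addxx addr0. Qed.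

(** The value of [det_coupling]: [x] and [y] are the determinants of the diagonal
    blocks, [x'] and [y'] those of the blocks with [ones] added. *)
Definition coupling (x x' y y' : 'F_2) := x * y' + x' * y + x' * y'.

Lemma det_hankel_coupling p q g N h M :
  \det (block_mx (hankel_mx p p g N) ones ones (hankel_mx q q h M)) =
  coupling (hankel_det p g N) (hankel_det p (compl g) N)
           (hankel_det q h M) (hankel_det q (compl h) M).
Proof. by rewrite det_coupling /hankel_det !hankel_mx_compl. Qed.

(** The rows and the columns of even index come first, [b + k] of them, then the
    [k] ones of odd index. *)
Lemma hankel_det_parity (b : bool) k (f : nat -> 'F_2) N :
  hankel_det (b + k + k) f N =
  \det (block_mx (\matrix_(i < b + k, j < b + k) f (N + (i + j).*2)%N)
                 (\matrix_(i, j) f (N + (i + j).*2.+1)%N)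
                 (\matrix_(i, j) f (N + (i + j).*2.+1)%N)
                 (\matrix_(i < k, j < k) f (N + (i + j).*2.+2)%N)).
Proof.
(* [h x] is the original index of the row that is moved to place [x]. *)
pose h (x : nat) := (if x < b + k then x.*2 else (x - (b + k)).*2.+1)%N.
have h_lt (x : 'I_(b + k + k)) : (h x < b + k + k)%N.
  by rewrite /h; case: ifP; have := ltn_ord x; lia.
pose hh x := Ordinal (h_lt x).
have hh_inj : injective hh.
  move=> x y [] /eqP; rewrite /h => e; apply: val_inj => /=.
  by move: e; do 2 case: ifP; lia.
rewrite /hankel_det -(det_reindex (hankel_mx _ _ f N) (erefl _) hh_inj).
have hl (i : 'I_(b + k)) : h (lshift k i) = i.*2 by rewrite /h /= ltn_ord.
have hr (i : 'I_k) : h (rshift (b + k) i) = i.*2.+1.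
  by rewrite /h /= ltnNge leq_addr addKn.
congr (\det _); apply/matrixP=> x y; rewrite 2![LHS]mxE /=.
case: (split_ordP x) => i ->; case: (split_ordP y) => j ->;
  rewrite ?(block_mxEul, block_mxEur, block_mxEdl, block_mxEdr) mxE ?hl ?hr;
  by congr f; lia.
Qed.

Lemma parityE n m :
  ((n.*2 + m.*2)%N = (n + m).*2) * ((n.*2 + m.*2.+1)%N = (n + m).*2.+1) *
  ((n.*2 + m.*2.+2)%N = (n + m).+1.*2) * ((n.*2.+1 + m.*2)%N = (n + m).*2.+1) *
  ((n.*2.+1 + m.*2.+1)%N = (n + m).+1.*2) *
  ((n.*2.+1 + m.*2.+2)%N = (n + m).+1.*2.+1).
Proof. by do !split; lia. Qed.

(* Entrywise identities between values of [f]: the indices are brought to a normal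
   form, after which the values of [f] are the only atoms.  The ordinals are
   generalized to naturals beforehand because their type mentions sums. *)
Ltac F2_normal :=
  repeat match goal with
    |- context [nat_of_ord ?i] => move: (nat_of_ord i) => ?
  end;
  rewrite /compl /diff; do ?rewrite !(add1n, addn1, addSn, addnS, addnA).
Ltac F2_decide f := F2_normal;
  repeat match goal with |- context [f ?n] => generalize (f n) end;
  do ?elim/F2_ind; exact: val_inj.

(** * Halving the Hankel determinants *)

Section Doubling.
Variable f : nat -> 'F_2.
Hypothesis f_even : forall n, f n.*2 = f n.
Hypothesis f_odd : forall n, f n.*2.+1 = f n + 1.

Lemma diff_even n : diff f n.*2 = 1.
Proof. by rewrite /diff f_even f_odd addrA F2_addxx add0r. Qed.

Lemma diff_odd n : diff f n.*2.+1 = diff f n + 1.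
Proof. by rewrite /diff f_odd -doubleS f_even addrAC. Qed.

(** The shear by the even rows leaves [ones] off the diagonal, and the Hankel matrix
    of the difference sequence in the odd block. *)
Lemma hankel_det_even (b : bool) k n :
  hankel_det (b + k + k) f n.*2 =
  coupling (hankel_det (b + k) f n) (hankel_det (b + k) (compl f) n)
           (hankel_det k (diff f) n) (hankel_det k (compl (diff f)) n).
Proof.
rewrite hankel_det_parity -det_hankel_coupling.
rewrite (det_shear (widen_ord (leq_addl b k))).
congr (\det (block_mx _ _ _ _)); apply/matrixP=> i j;
  rewrite !mxE /= !parityE ?f_even ?f_odd; F2_decide f.
Qed.

(** At an odd offset the terms in row [2 i + 1] and in row [2 i + 2] have the form
    [f (2 m)] and [f (2 m + 1)] at even columns, so these two rows are the ones
    whose sum is constant there. *)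
Lemma hankel_det_odd_odd k n :
  hankel_det (1 + k + k) f n.*2.+1 =
  coupling (hankel_det (1 + k) (compl f) n) (hankel_det (1 + k) f n)
           (hankel_det k (diff f) n.+1) (hankel_det k (compl (diff f)) n.+1).
Proof.
rewrite (hankel_det_parity true).
rewrite (det_shear (@rshift 1 k)).
rewrite -(eq_hankel_det _ _ (complK f)) -det_hankel_coupling.
congr (\det (block_mx _ _ _ _)); apply/matrixP=> i j;
  rewrite !mxE /= !parityE ?f_even ?f_odd; F2_decide f.
Qed.

(** Here the last odd row has no even successor, so the even rows are reduced by
    the odd ones instead; hence the exchange of the two diagonal blocks. *)
Lemma hankel_det_odd_even k n :
  hankel_det (k + k) f n.*2.+1 =
  coupling (hankel_det k (compl f) n.+1) (hankel_det k f n.+1)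
           (hankel_det k (diff f) n) (hankel_det k (compl (diff f)) n).
Proof.
rewrite (hankel_det_parity false).
rewrite det_swap_blocks -det_tr tr_block_mx det_swap_blocks -det_tr tr_block_mx.
rewrite (det_shear (@id 'I_k)).
rewrite -(eq_hankel_det _ _ (complK f)) -det_hankel_coupling.
congr (\det (block_mx _ _ _ _)); apply/matrixP=> i j;
  rewrite !mxE /= !parityE ?f_even ?f_odd; F2_decide f.
Qed.

(** The terms of even index of [diff f] are 1, so that at an odd offset the
    off-diagonal blocks are already [ones], and vanish for the complement. *)
Lemma hankel_det_diff_odd (b : bool) k n :
  hankel_det (b + k + k) (diff f) n.*2.+1 =
  coupling (hankel_det (b + k) (compl (diff f)) n)
           (hankel_det (b + k) (diff f) n)
           (hankel_det k (compl (diff f)) n.+1)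
           (hankel_det k (diff f) n.+1).
Proof.
rewrite hankel_det_parity.
rewrite -!(eq_hankel_det _ _ (complK (diff f))) -det_hankel_coupling.
congr (\det (block_mx _ _ _ _)); apply/matrixP=> i j;
  rewrite !mxE /= !parityE ?diff_even ?diff_odd; F2_decide f.
Qed.

Lemma hankel_det_compl_diff_odd (b : bool) k n :
  hankel_det (b + k + k) (compl (diff f)) n.*2.+1 =
  hankel_det (b + k) (diff f) n * hankel_det k (diff f) n.+1.
Proof.
rewrite hankel_det_parity -(det_ublock _ 0).
congr (\det (block_mx _ _ _ _)); apply/matrixP=> i j;
  rewrite !mxE /= !parityE /compl ?diff_even ?diff_odd; F2_decide f.
Qed.

(** At an even offset the diagonal blocks are constant.  The determinant is a
    square, and every element of the field is equal to its square. *)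
Lemma hankel_det_compl_diff_even_even k n :
  hankel_det (k + k) (compl (diff f)) n.*2 = hankel_det k (diff f) n.
Proof.
rewrite (hankel_det_parity false) -[RHS]F2_mulxx.
rewrite -(det_zero_ulblock _ _ 0).
congr (\det (block_mx _ _ _ _)); apply/matrixP=> i j;
  rewrite !mxE /= !parityE /compl ?diff_even ?diff_odd; F2_decide f.
Qed.

Lemma hankel_det_diff_even_even k n :
  hankel_det (k + k) (diff f) n.*2 = hankel_det k (diff f) n.
Proof.
rewrite (hankel_det_parity false) -[RHS]F2_mulxx.
rewrite (det_shear (@id 'I_k)).
rewrite -(det_zero_drblock _ _ ones).
congr (\det (block_mx _ _ _ _)); apply/matrixP=> i j;
  rewrite !mxE /= !parityE /compl ?diff_even ?diff_odd; F2_decide f.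
Qed.

Lemma hankel_det_compl_diff_even_odd k n :
  hankel_det (1 + k + k) (compl (diff f)) n.*2 = 0.
Proof.
rewrite (hankel_det_parity true).
rewrite [\matrix_(i < 1 + k, j < 1 + k) _](_ : _ = 0).
  exact: det_large_zero_block.
by apply/matrixP=> i j; rewrite !mxE !parityE /compl diff_even F2_addxx.
Qed.

(** The top left entry 1 is a pivot whose Schur complement has a zero diagonal
    block, which gives the square of a [k x k] determinant; that determinant is
    the one of [det_complement_diff] for the Hankel matrix of [f]. *)
Lemma hankel_det_diff_even_odd k n :
  hankel_det (1 + k + k) (diff f) n.*2 =
  hankel_det (1 + k) f n + hankel_det (1 + k) (compl f) n.
Proof.
rewrite [in RHS]/hankel_det hankel_mx_compl det_complement_diff.
pose g m := diff f m + 1.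
pose b : 'rV_k := \row_j g (n + j)%N.
pose B : 'M_k := \matrix_(i, j) g (n + i + j).+1%N.
transitivity (\det (block_mx 1%:M (row_mx ones b) (col_mx ones b^T)
                             (block_mx ones B B^T ones))).
{ (* [b] is the first even row at odd columns, [B] the other even rows *)
  rewrite (hankel_det_parity true) block_mxA castmx_id.
  congr (\det (block_mx _ _ _ _)); apply/matrixP=> i j; rewrite !mxE.
  all: try (case: splitP => i' ->); rewrite ?mxE;
    try (case: splitP => j' ->); rewrite ?mxE ?ord1 ?parityE ?diff_even //.
  all: by rewrite /g ?diff_odd; congr (diff f _ + 1) => /=; lia. }
rewrite det_pivot1 mul_col_row F2_mul_ones opp_block_mx add_block_mx.
rewrite !F2_oppmx F2_addmx det_zero_ulblock -[X in _ = X]F2_mulxx.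
congr (_ * _); last rewrite -det_tr; congr (\det _); apply/matrixP=> i j;
  rewrite !mxE ?big_ord1 !mxE /= /bump leqNgt ltn_ord /g /= !addn0; F2_decide f.
Qed.

End Doubling.

(** * The Thue-Morse sequence and its table of determinants *)

Definition tm n := thue_morse n.+1.

Lemma nth_mu_word (w : seq letter) k : (k < size w)%N ->
  nth la (mu_word w) k.*2 = nth la w k /\
  tau (nth la (mu_word w) k.*2.+1) = tau (nth la w k) + 1.
Proof.
elim: w k => [|x w IH] [|k] //= kw; last by case: x; apply: IH.
by case: x; split=> //=; apply: val_inj.
Qed.

Lemma mu_inf_double k :
  mu_inf k.*2 = mu_inf k /\ tau (mu_inf k.*2.+1) = tau (mu_inf k) + 1.
Proof.
have kl : (k < 2 ^ k)%N by rewrite ltn_expl.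
rewrite (mu_infE kl) !(@mu_infE k.+1) ?expnS; try lia.
rewrite /mu_iter iterS -/(mu_iter k).
by apply: nth_mu_word; rewrite size_mu_iter.
Qed.

Lemma tm_even n : tm n.*2 = tm n.
Proof. by rewrite /tm /thue_morse /= (mu_inf_double n).1. Qed.

Lemma tm_odd n : tm n.*2.+1 = tm n + 1.
Proof. by rewrite /tm /thue_morse /= (mu_inf_double n).2. Qed.

Lemma ctm_even n : compl tm n.*2 = compl tm n.
Proof. by rewrite /compl tm_even. Qed.

Lemma ctm_odd n : compl tm n.*2.+1 = compl tm n + 1.
Proof. by rewrite /compl tm_odd. Qed.

Definition couple (x x' y y' : bool) := (x && y') (+) (x' && y) (+) (x' && y').

Lemma nz_coupling x x' y y' :
  nz (coupling x x' y y') = couple (nz x) (nz x') (nz y) (nz y').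
Proof. by rewrite /coupling !nzD !nzM. Qed.

(** Vanishing at negative sizes is consistent with the halving rules, so these
    hold for all integer sizes. *)
Definition hdet (s : int) f N : 'F_2 :=
  if s is Posz k then hankel_det k f N else 0.

Definition quad := (bool * bool * bool * bool)%type.
Definition table (s : int) (N : nat) : quad :=
  (nz (hdet s tm N), nz (hdet s (compl tm) N),
   nz (hdet s (diff tm) N), nz (hdet s (compl (diff tm)) N)).

(** The halving rules in boolean form: [q00], [q10] and [q01] are the quadruples
    at [(k, n)], [(k + 1, n)] and [(k, n + 1)], and the result is the quadruple at
    [(2 k + b, 2 n + e)]. *)
Definition halve (b e : bool) (q00 q10 q01 : quad) : quad :=
  let: (a, a', d, d') := if b then q10 else q00 in
  let: (_, _, d0, d0') := q00 in
  let: (a1, a1', d1, d1') := q01 in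
  if e then
    let: (x, x', y, y') :=
      if b then (a, a', d1, d1') else (a1, a1', d0, d0') in
    (couple x' x y y', couple x x' y y', couple d' d d1' d1, d && d1)
  else
    (couple a a' d0 d0', couple a' a d0 d0',
     if b then a (+) a' else d, if b then false else d).

Lemma table_halve_nat (b e : bool) (k n : nat) :
  table (b + k + k)%N (e + n.*2) =
  halve b e (table k n) (table k.+1 n) (table k n.+1).
Proof.
have cc := eq_hankel_det _ _ (complK tm).
have dc := eq_hankel_det _ _ (diff_compl tm).
have cdc := eq_hankel_det _ _ (compl_ext (diff_compl tm)).
rewrite /table /hdet; case: e; rewrite ?add1n ?add0n.
  rewrite (hankel_det_diff_odd tm_even tm_odd b).
  rewrite (hankel_det_compl_diff_odd tm_even tm_odd b).
  case: b; rewrite ?add1n ?add0n /halve.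
    rewrite -add1n (hankel_det_odd_odd tm_even tm_odd).
    rewrite (hankel_det_odd_odd ctm_even ctm_odd) cc dc cdc.
    by rewrite !nz_coupling nzM.
  rewrite (hankel_det_odd_even tm_even tm_odd).
  rewrite (hankel_det_odd_even ctm_even ctm_odd) cc dc cdc.
  by rewrite !nz_coupling nzM.
rewrite (hankel_det_even tm_even tm_odd b).
rewrite (hankel_det_even ctm_even ctm_odd b) cc dc cdc.
case: b; rewrite ?add1n ?add0n /halve.
  rewrite -add1n (hankel_det_diff_even_odd tm_even tm_odd).
  rewrite (hankel_det_compl_diff_even_odd tm_even tm_odd).
  by rewrite !nz_coupling nzD.
rewrite (hankel_det_diff_even_even tm_even tm_odd).
rewrite (hankel_det_compl_diff_even_even tm_even tm_odd).
by rewrite !nz_coupling.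
Qed.

Definition quad0 : quad := (false, false, false, false).
Definition quad1 : quad := (true, true, true, true).

Lemma table_neg j N : table (Negz j) N = quad0.
Proof. by []. Qed.

Lemma table0 N : table 0 N = quad1.
Proof.
have e f : hdet 0 f N = 1 by exact: det_mx00.
by rewrite /table !e.
Qed.

Lemma table_halve (b e : bool) (k : int) (n : nat) :
  table (k * 2 + b%:Z) (e + n.*2) =
  halve b e (table k n) (table (k + 1) n) (table k n.+1).
Proof.
case: k => k.
  rewrite (_ : Posz k * 2 + b%:Z = (b + k + k)%N :> int); last by case: b; lia.
  by rewrite table_halve_nat; rewrite -[k%:Z + 1]/(Posz (k + 1)) addn1.
rewrite (_ : Negz k * 2 + b%:Z = Negz (k.*2.+1 - b)); last by case: b; lia.
rewrite !table_neg.
(* For [k = -1] and [b = 1] the rule reads off the row of size 0 as well. *)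
case: k => [|k].
  by rewrite (_ : _ + 1 = 0) ?table0; [case: b; case: e|lia].
rewrite (_ : _ + 1 = Negz k) ?table_neg; [by case: b; case: e|lia].
Qed.

Lemma det1_hankel f N : hankel_det 1 f N = f N.
Proof. by rewrite /hankel_det det_mx11 mxE !addn0. Qed.

Lemma table1 N : table 1 N =
  (nz (tm N), ~~ nz (tm N),
   nz (tm N) (+) nz (tm N.+1), ~~ (nz (tm N) (+) nz (tm N.+1))).
Proof. by rewrite /table /= !det1_hankel /compl /diff !nzD !addbT. Qed.

(** * Numerical codes of the tiles *)

(** Tiles contain ordinals, whose bound proofs would be dragged along by
    evaluation; natural numbers avoid this. *)
Definition tile_code (t : tile) : nat :=
  match t with
  | TA i => i | TB i => 4 + i | TC i => 8 + i | TDa => 12 | TDb => 13 | TO => 14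
  end.

(** Row [tile_code s] lists the codes of the entries of [sigma s], row by row. *)
Definition subst_table : seq (seq nat) :=
  [:: [:: 0; 8; 12; 4];
      [:: 13; 5; 1; 9];
      [:: 6; 12; 10; 2];
      [:: 11; 3; 7; 13];
      [:: 4; 8; 13; 0];
      [:: 12; 1; 5; 9];
      [:: 2; 13; 10; 6];
      [:: 11; 7; 3; 12];
      [:: 14; 14; 8; 14];
      [:: 9; 14; 14; 14];
      [:: 14; 10; 14; 14];
      [:: 14; 14; 14; 11];
      [:: 5; 2; 0; 7];
      [:: 1; 6; 4; 3];
      [:: 14; 14; 14; 14]]%N.

Definition kappa_positions (c : nat) : seq (nat * nat) :=
  let rot (s : seq (nat * nat)) := [seq (p.2, (6 - p.1)%N) | p <- s] in
  match c %/ 4 with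
  | 0 => iter (c %% 4) rot
           [:: (1, 2); (2, 3); (3, 2); (3, 4); (4, 1); (4, 3); (4, 5); (5, 2)]
  | 1 => iter (c %% 4) rot
           [:: (1, 2); (2, 1); (2, 3); (3, 4); (4, 5); (5, 4)]
  | 2 => iter (c %% 4) rot [:: (4, 1); (5, 2)]
  | _ => nth [::]
           [:: [:: (1, 2); (2, 3); (2, 5); (3, 2);
                   (3, 4); (4, 1); (4, 3); (5, 4)];
               [:: (1, 4); (2, 1); (2, 3); (3, 2);
                   (3, 4); (4, 3); (4, 5); (5, 2)]] (c %% 4)
  end%N.

Lemma sigma_code t (x y : 'I_2) :
  tile_code (sigma t x y) =
  nth 0%N (nth [::] subst_table (tile_code t)) (x.*2 + y).
Proof.
case: t => [i|i|i|||]; try (case: i => [[|[|[|[|//]]]] ?]);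
case: x => [[|[|//]] ?]; case: y => [[|[|//]] ?].
all: rewrite /sigma /act_mx /act_geo /act_ent /act_of_gen.
all: by rewrite !mxE.
Qed.

Lemma kappa1_code t (i j : 'I_4) :
  kappa1 t i j = ((i.+1, j.+1) \in kappa_positions (tile_code t))%:R.
Proof.
case: t => [u|u|u|||]; try (case: u => [[|[|[|[|//]]]] ?]);
case: i => [[|[|[|[|//]]]] ?]; case: j => [[|[|[|[|//]]]] ?].
all: by rewrite !mxE.
Qed.

(** * Windows of determinants *)

Definition grid := seq (seq quad).
Definition tabulate (q : nat -> nat -> quad) : grid :=
  mkseq (fun u => mkseq (q u) 6) 6.
Definition cell (S : grid) u v : quad := nth quad0 (nth [::] S u) v.

Lemma cell_tabulate q u v :
  (u < 6)%N -> (v < 6)%N -> cell (tabulate q) u v = q u v.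
Proof. by move=> u6 v6; rewrite /cell !nth_mkseq. Qed.

Lemma eq_tabulate q q' :
  (forall u v, (u < 6)%N -> (v < 6)%N -> q u v = q' u v) ->
  tabulate q = tabulate q'.
Proof.
move=> e; apply/eq_in_map => u; rewrite mem_iota => /andP[_ u6].
by apply/eq_in_map => v; rewrite mem_iota => /andP[_ v6]; apply: e.
Qed.

(** The entry of the array at row [4 I + r] and column [4 J + c], counted from 0,
    is a determinant of offset [4 J + c] and size [2 (I - J) + (r - c + 1) / 2].
    These sizes start at [2 (I - J) - 1] and these offsets at [4 J]; the window
    starts at size [2 (I - J) - 2] and has width 6 in both directions because this
    is what remains sufficient when [window_refine] is iterated. *)
Definition window (I J : nat) : grid :=
  tabulate (fun u v => table ((I%:Z - J%:Z) * 2 + u%:Z - 2) (4 * J + v)).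

(** Halving the sizes of the window of [(2 I + x, 2 J + y)] shifts the first one by
    [x - y + 1] relative to the window of [(I, J)]; halving its offsets shifts
    them by [2 y]. *)
Definition refine (x y : bool) (S : grid) : grid :=
  tabulate (fun u v =>
    let u' := (x + ~~ y + u./2)%N in
    let v' := (y.*2 + v./2)%N in
    halve (odd u) (odd v) (cell S u' v') (cell S u'.+1 v') (cell S u' v'.+1)).

Lemma window_refine (x y : bool) I J :
  window (x + I.*2) (y + J.*2) = refine x y (window I J).
Proof.
apply: eq_tabulate => u v u6 v6; rewrite /window; cbv beta zeta.
rewrite !cell_tabulate; try by case: x; case: y; lia.
have yy : (y + ~~ y = 1)%N by case: y.
set k : int := (I%:Z - J%:Z) * 2 + (x + ~~ y + u./2)%:Z - 2.
set n := (4 * J + (y.*2 + v./2))%N.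
rewrite (_ : _ - 2 = k * 2 + (odd u)%:Z); last by rewrite /k; lia.
rewrite (_ : (4 * _ + v)%N = (odd v + n.*2)%N); last by rewrite /n; lia.
rewrite table_halve; congr (halve _ _ _ (table _ _) (table _ _)).
- by rewrite /k; lia.
- by rewrite /n; lia.
Qed.

Definition tm_bits := [:: false; true; true; false; true; false; false].

Lemma tm_bitsE n : (n < 7)%N -> nz (tm n) = nth false tm_bits n.
Proof. by do 7!case: n => [|n] //. Qed.

(** In the window at the origin the rows of size at most 0 are constant, the row of
    size 1 consists of terms of the sequences, and the rows of sizes 2 and 3 are
    obtained from these by halving. *)
Definition size1 N : quad :=
  let a := nth false tm_bits N in let a' := nth false tm_bits N.+1 in
  (a, ~~ a, a (+) a', ~~ (a (+) a')).
Definition size2 N : quad :=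
  (* [quad0] stands in for the value at size 2, the one being computed. *)
  halve false (odd N) (size1 N./2) quad0 (size1 N./2.+1).
Definition size3 N : quad :=
  halve true (odd N) (size1 N./2) (size2 N./2) (size1 N./2.+1).
Definition initial_window : grid :=
  tabulate (fun u v =>
    nth quad0 [:: quad0; quad0; quad1; size1 v; size2 v; size3 v] u).

Lemma halve_even_size e q00 q10 q10' q01 :
  halve false e q00 q10 q01 = halve false e q00 q10' q01.
Proof. by []. Qed.

Lemma window00 : window 0 0 = initial_window.
Proof.
have t1 v : (v < 6)%N -> table 1 v = size1 v.
  by move=> v6; rewrite table1 !tm_bitsE //; lia.
have v2 v : v = (odd v + v./2.*2)%N by rewrite odd_double_half.
have t2 v : (v < 6)%N -> table 2 v = size2 v.
  move=> v6; rewrite {1}(v2 v) (table_halve false _ 1) /size2 !t1; try lia.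
  exact: halve_even_size.
have t3 v : (v < 6)%N -> table 3 v = size3 v.
  by move=> v6; rewrite {1}(v2 v) (table_halve true _ 1) /size3 !t1 ?t2 //; lia.
apply: eq_tabulate => u v u6 v6; rewrite muln0 add0n.
case: u u6 => [|[|[|[|[|[|//]]]]]] _ /=.
- exact: table_neg.
- exact: table_neg.
- exact: table0.
- exact: t1.
- exact: t2.
- exact: t3.
Qed.

(** * The automaton of tiles and windows *)

Definition state := (nat * grid)%type.
Definition child (x y : bool) (p : state) : state :=
  (nth 0%N (nth [::] subst_table p.1) (x.*2 + y), refine x y p.2).
Definition children (p : state) : seq state :=
  [seq child x y p | x <- [:: false; true], y <- [:: false; true]].

(** Row [u] of a window has size [2 (I - J) - 2 + u], so the size of the entry at
    position [(r, c)] of the block is found in row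
    [(r - c + 1) / 2 + 2 = (r - c + 5) / 2]. *)
Definition coded (p : state) : bool :=
  all (fun r => all (fun c =>
    ((r.+1, c.+1) \in kappa_positions p.1) ==
    odd (r + c) && (cell p.2 (r + 5 - c)./2 c).1.1.1) (iota 0 4)) (iota 0 4).

Definition root : state := (0%N, initial_window).

Fixpoint explore fuel (todo seen : seq state) : seq state :=
  match fuel, todo with
  | fuel'.+1, p :: todo' =>
      if p \in seen then explore fuel' todo' seen
      else explore fuel' (children p ++ todo') (p :: seen)
  | _, _ => seen
  end.

(** There are 182 reachable pairs.  The set is hidden behind an existential
    quantifier so that it is never evaluated again. *)
Lemma coding_invariant : exists2 R : seq state, root \in R &
  all (fun p => coded p && all (mem R) (children p)) R.
Proof.
(* Each pair is expanded once and has four children, which bounds the number of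
   steps by 5 * 182. *)
pose check (R : seq state) := (root \in R) &&
  all (fun p => coded p && all (mem R) (children p)) R.
suff: check (explore 1000 [:: root] [::]).
  by case/andP; exists (explore 1000 [:: root] [::]).
by vm_compute.
Qed.

Lemma sigma_inf_double (x y : bool) I J :
  sigma_inf (x + I.*2) (y + J.*2) = sigma (sigma_inf I J) (inord x) (inord y).
Proof.
have [Il Jl] := sigma_inf_subproof I J.
move: (maxn I J) Il Jl => l Il Jl.
have Il' : (x + I.*2 < 2 ^ l.+1)%N by rewrite expnS; case: x; lia.
have Jl' : (y + J.*2 < 2 ^ l.+1)%N by rewrite expnS; case: y; lia.
rewrite -[(x + _)%N]/(val (Ordinal Il')) -[(y + _)%N]/(val (Ordinal Jl')).
rewrite sigma_infE -{2}[I]/(val (Ordinal Il)) -{2}[J]/(val (Ordinal Jl)).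
rewrite sigma_infE /=.
rewrite castmxE mxE; congr (sigma (sigma_iter _ _ _) _ _); apply: val_inj => /=.
- by case: x {Il'}; lia.
- by case: y {Jl'}; lia.
- by rewrite inordK; case: x {Il'}; lia.
- by rewrite inordK; case: y {Jl'}; lia.
Qed.

Definition state_at I J : state := (tile_code (sigma_inf I J), window I J).

Lemma state_at_double (x y : bool) I J :
  state_at (x + I.*2) (y + J.*2) = child x y (state_at I J).
Proof.
rewrite /state_at window_refine sigma_inf_double sigma_code /child /=.
by rewrite !inordK; [|case: y|case: x].
Qed.

Lemma state_at_coded I J : coded (state_at I J).
Proof.
have [R root_R /allP R_inv] := coding_invariant.
suff: state_at I J \in R by move=> /R_inv/andP[].
have [s] := ubnP (I + J)%N; elim: s I J => // s IH I J IJ.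
have [IJ0|IJ0] := posnP (I + J)%N.
  have [-> ->] : I = 0%N /\ J = 0%N by lia.
  rewrite /state_at window00 (_ : tile_code _ = 0%N) ?root_R //.
  by rewrite /sigma_inf /= mxE.
rewrite -(odd_double_half I) -(odd_double_half J) state_at_double.
have /R_inv/andP[_ /allP] := IH I./2 J./2 ltac:(lia).
apply; apply/allpairsP; exists (odd I, odd J).
by split=> //=; rewrite !inE; case: odd.
Qed.

Lemma hankel_hdet (f : nat -> 'F_2) s n :
  hankel f s n.+1 = hdet s (fun k => f k.+1) n.
Proof.
by case: s => [[|k]|k] //=; rewrite /hankel_det det_mx00.
Qed.

Theorem theorem1p3 (m n : nat) (m_gt0 : (0 < m)%N) (n_gt0 : (0 < n)%N) :
  hankel_array thue_morse m n = subst_array kappa1 sigma_inf m.-1 n.-1.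
Proof.
case: m n m_gt0 n_gt0 => [//|i] [//|j] _ _ /=.
rewrite /subst_array kappa1_code !inordK ?ltn_pmod //.
have := state_at_coded (i %/ 4) (j %/ 4).
have r4 : (i %% 4 < 4)%N by rewrite ltn_pmod.
have c4 : (j %% 4 < 4)%N by rewrite ltn_pmod.
move=> /allP/(_ (i %% 4)%N); rewrite mem_iota => /(_ r4).
move=> /allP/(_ (j %% 4)%N); rewrite mem_iota => /(_ c4) /eqP ->.
rewrite /hankel_array cell_tabulate; try lia.
case: ifP => par.
  by rewrite (_ : odd _ = false) //; move/eqP: par; lia.
rewrite (_ : odd _ = true); last by move/eqP: par; lia.
rewrite hankel_hdet -[LHS]nzK /=; congr (nz (hdet _ _ _))%:R; last lia.
by move/eqP: par; lia.
Qed.
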